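(* For all integers $m,d\geq 1$, $$Q_{U_{m,d}}(t)=\binom{m+d}{d}\sum_{j=0}^{\lfloor (d-1)/2\rfloor}\frac{m(d-2j)}{(m+j)(m+d-j)}\binom{d}{j}t^j.$$
   Context: $U_{m,d}$ denotes the uniform matroid of rank $d$ on $m+d$ elements (independent sets are the subsets of size at most $d$). For a matroid $M$ on ground set $E$, $L(M)$ is its lattice of flats with minimal element $\hat 0=\mathrm{cl}(\emptyset)$ and maximal element $E$; for a flat $F$, $M_F$ is the restriction of $M$ to $F$ and $M^F$ is the contraction $M/F$. The characteristic polynomial is $\chi_M(t)=\sum_{F\in L(M)}\mu_{L(M)}(\hat 0,F)\,t^{\mathrm{rk}\,M-\mathrm{rk}\,F}$. The inverse Kazhdan–Lusztig polynomial $Q_M(t)\in\mathbb{Z}[t]$ is the unique assignment to each matroid such that $Q_M=1$ if $\mathrm{rk}\,M=0$, $\deg Q_M<\frac12\mathrm{rk}\,M$ if $\mathrm{rk}\,M>0$, and $t^{\mathrm{rk}\,M}(-1)^{\mathrm{rk}\,M}Q_M(t^{-1})=\sum_{F\in L(M)}(-1)^{\mathrm{rk}\,M_F}Q_{M_F}(t)\,t^{\mathrm{rk}\,M^F}\chi_{M^F}(t^{-1})$ for every $M$. *)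

(* Defs.v *)
From mathcomp Require Import all_boot all_order all_algebra.

Set Implicit Arguments.
Unset Strict Implicit.
Unset Printing Implicit Defensive.

Import GRing.Theory.

(* The ground set of a matroid is a subset of a finite type, so that
   restrictions and contractions live over the same type.  The axioms are
   boolean, hence a matroid is determined by its ground set and its
   independent sets. *)

Definition is_matroid (T : finType) (E : {set T}) (D : {set {set T}}) : bool :=
  [&& set0 \in D,
      [forall I in D, I \subset E],
      [forall J in D, forall I : {set T}, (I \subset J) ==> (I \in D)] &
      [forall I in D, forall J in D,
         (#|I| < #|J|) ==> [exists x in J :\: I, x |: I \in D]]].

Record matroid (T : finType) := Matroid {
  ground : {set T};
  indep : {set {set T}};
  matroid_axiom : is_matroid ground indep
}.

Lemma is_matroidP (T : finType) (E : {set T}) (D : {set {set T}}) :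
  reflect
    [/\ set0 \in D,
        forall I, I \in D -> I \subset E,
        forall I J : {set T}, I \subset J -> J \in D -> I \in D &
        forall I J, I \in D -> J \in D -> #|I| < #|J| ->
          exists2 x, x \in J :\: I & x |: I \in D]
    (is_matroid E D).
Proof.
apply: (iffP and4P) => [[D0 /forall_inP DE /forall_inP DS /forall_inP DA]|].
  split=> // [I J sIJ DJ | I J DI DJ ltIJ].
    by have /forallP/(_ I)/implyP := DS J DJ; apply.
  have /forall_inP/(_ J DJ)/implyP/(_ ltIJ)/exists_inP := DA I DI.
  by case=> x; exists x.
case=> D0 DE DS DA; split=> //; first exact/forall_inP.
  by apply/forall_inP=> J DJ; apply/forallP=> I; apply/implyP=> /DS; apply.
apply/forall_inP=> I DI; apply/forall_inP=> J DJ; apply/implyP=> /(DA I J DI DJ).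
by case=> x ? ?; apply/exists_inP; exists x.
Qed.

Lemma matroid_eq (T : finType) (M N : matroid T) :
  ground M = ground N -> indep M = indep N -> M = N.
Proof.
case: M N => [E D HM] [E' D' HN] /= eqE eqD.
by case: _ / eqE in HN *; case: _ / eqD in HN *; rewrite (bool_irrelevance HM HN).
Qed.

Section MatroidNotions.
Variables (T : finType) (M : matroid T).
Implicit Types A F I : {set T}.

Definition rk A : nat := \max_(I in indep M | I \subset A) #|I|.

Definition mrank : nat := rk (ground M).

Definition cl A : {set T} := [set x in ground M | rk (x |: A) == rk A].

Definition flats : {set {set T}} :=
  [set F : {set T} | F \subset ground M & cl F == F].

Lemma rk_ge A I : I \in indep M -> I \subset A -> #|I| <= rk A.
Proof.
by move=> DI sIA; rewrite /rk (bigD1 I) ?DI //= leq_maxl.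
Qed.

Lemma rkP A : exists2 I, (I \in indep M) && (I \subset A) & #|I| = rk A.
Proof.
have [D0 _ _ _] := is_matroidP _ _ (matroid_axiom M).
have P0 : (set0 \in indep M) && (set0 \subset A) by rewrite D0 sub0set.
have cardP : 0 < #|[pred I : {set T} | (I \in indep M) && (I \subset A)]|.
  by apply/card_gt0P; exists set0.
have [I PI eqI] := eq_bigmax_cond (fun I : {set T} => #|I|) cardP.
by exists I.
Qed.

Lemma rk_le_card A : rk A <= #|A|.
Proof. by have [I /andP[_ sIA] <-] := rkP A; apply: subset_leq_card. Qed.

Lemma restrict_subproof A :
  is_matroid (ground M :&: A) [set I in indep M | I \subset A].
Proof.
have [D0 DE DS DA] := is_matroidP _ _ (matroid_axiom M).
apply/is_matroidP; split=> [|I|I J|I J].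
- by rewrite inE D0 sub0set.
- by rewrite inE subsetI => /andP[/DE-> ->].
- by rewrite !inE => sIJ /andP[/(DS _ _ sIJ)-> /(subset_trans sIJ)->].
- rewrite !inE => /andP[DI sIA] /andP[DJ sJA] ltIJ.
  have [x Jx DxI] := DA _ _ DI DJ ltIJ; exists x; rewrite // inE DxI.
  by rewrite subUset sub1set sIA andbT (subsetP sJA) //; case/setDP: Jx.
Qed.

Definition restrict A : matroid T := Matroid (restrict_subproof A).

(* The independent sets of M / A are those I disjoint from A whose rank
   rk (I :|: A) - rk A in M / A equals #|I|. *)
Definition contract_indep A : {set {set T}} :=
  [set I : {set T} | (I \subset ground M :\: A) && (rk (I :|: A) == #|I| + rk A)].

Lemma contract_indepP A I :
  reflect (I \subset ground M :\: A /\
           exists B : {set T}, [/\ B \subset A, #|B| = rk A & I :|: B \in indep M])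
          (I \in contract_indep A).
Proof.
have [D0 DE DS DA] := is_matroidP _ _ (matroid_axiom M).
rewrite inE; apply: (iffP andP) => [[sIE /eqP eqrk]|[sIE [B [sBA cB DIB]]]];
  split=> //.
- have [K /andP[DK sK] cK] := rkP (I :|: A).
  have leA : #|K :&: A| <= rk A.
    by apply: rk_ge; rewrite ?subsetIr //; apply: DS DK; apply: subsetIl.
  have eqK : K = (K :&: I) :|: (K :&: A) by rewrite -setIUr; apply/esym/setIidPl.
  have leI : #|K :&: I| <= #|I| by apply: subset_leq_card; apply: subsetIr.
  have leK : #|K| <= #|K :&: I| + #|K :&: A|.
    by rewrite {1}eqK; apply: leq_card_setU.
  rewrite cK eqrk in leK.
  have cI : #|I| <= #|K :&: I|.
    by rewrite -(leq_add2r (rk A)) (leq_trans leK) // leq_add2l.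
  have cA : #|K :&: A| = rk A.
    apply/eqP; rewrite eqn_leq leA /= -(leq_add2l #|I|) (leq_trans leK) //.
    by rewrite leq_add2r.
  have KI : K :&: I = I by apply/eqP; rewrite eqEcard subsetIr.
  by exists (K :&: A); rewrite subsetIr -{1}KI -eqK.
- have dIA : [disjoint I & A] by move: sIE; rewrite subsetD => /andP[].
  have dIB : [disjoint I & B] by rewrite (disjointWr sBA).
  rewrite eqn_leq; apply/andP; split; last first.
    by rewrite -cB -(cardsUI I B) (disjoint_setI0 dIB) cards0 addn0 rk_ge // setUS.
  have [K /andP[DK sK] <-] := rkP (I :|: A).
  have {1}-> : K = (K :&: I) :|: (K :&: A) by rewrite -setIUr; apply/esym/setIidPl.
  apply: leq_trans (leq_card_setU _ _) _; apply: leq_add.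
    by apply: subset_leq_card; apply: subsetIr.
  by apply: rk_ge; rewrite ?subsetIr //; apply: DS DK; apply: subsetIl.
Qed.

Lemma contract_subproof A : is_matroid (ground M :\: A) (contract_indep A).
Proof.
have [D0 DE DS DA] := is_matroidP _ _ (matroid_axiom M).
apply/is_matroidP; split=> [|I|I J sIJ|I J].
- by rewrite inE sub0set set0U cards0 add0n eqxx.
- by case/contract_indepP.
- case/contract_indepP=> sJE [B [sBA cB DJB]]; apply/contract_indepP.
  split; first exact: subset_trans sIJ sJE.
  by exists B; split=> //; apply: DS DJB; apply: setSU.
- case/contract_indepP=> sIE [B [sBA cB DIB]].
  case/contract_indepP=> sJE [C [sCA cC DJC]] ltIJ.
  have dj (X Y : {set T}) : X \subset ground M :\: A -> Y \subset A ->
      #|X :|: Y| = #|X| + #|Y|.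
    rewrite subsetD => /andP[_ dXA] sYA.
    by rewrite -(cardsUI X Y) (disjoint_setI0 (disjointWr sYA dXA)) cards0 addn0.
  have [|x] := DA _ _ DIB DJC; first by rewrite !dj // cB cC ltn_add2r.
  rewrite !inE negb_or => /andP[/andP[nIx nBx] JCx] DxIB.
  have Jx : x \in J.
    case/orP: JCx => // Cx; have Ax := subsetP sCA x Cx.
    have : #|x |: B| <= rk A.
      apply: rk_ge; last by rewrite subUset sub1set Ax.
      by apply: DS DxIB; apply: setUS; apply: subsetUr.
    by rewrite cardsU1 nBx cB ltnn.
  exists x; first by rewrite inE nIx.
  apply/contract_indepP; split; first by rewrite subUset sub1set (subsetP sJE).
  by exists B; rewrite -setUA.
Qed.

Definition contract A : matroid T := Matroid (contract_subproof A).

End MatroidNotions.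

Lemma uniform_subproof (m d : nat) :
  is_matroid [set: 'I_(m + d)] [set I : {set 'I_(m + d)} | #|I| <= d].
Proof.
apply/is_matroidP; split=> [|I|I J|I J]; rewrite ?inE ?cards0 ?subsetT //.
  by move=> sIJ; apply: leq_trans; apply: subset_leq_card.
move=> _ cJ ltIJ; have /subsetPn[x Jx nIx] : ~~ (J \subset I).
  by apply: contraL ltIJ => /subset_leq_card; rewrite -leqNgt.
by exists x; rewrite inE ?nIx // cardsU1 nIx; apply: leq_trans ltIJ cJ.
Qed.

Definition uniform (m d : nat) : matroid 'I_(m + d) := Matroid (uniform_subproof m d).

Local Open Scope ring_scope.

(* The Moebius function of a family L of sets ordered by inclusion, computed by
   recursion on an upper bound n for the size of B; mobiusE is the defining
   recurrence. *)
Fixpoint mobius_rec (T : finType) (L : {set {set T}}) (n : nat) (A B : {set T}) : int :=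
  if A == B then 1 else
  if n is n'.+1 then
    - \sum_(C in L | (A \subset C) && (C \proper B)) mobius_rec L n' A C
  else 0.

Definition mobius (T : finType) (L : {set {set T}}) (A B : {set T}) : int :=
  mobius_rec L #|B| A B.

Lemma mobiusE (T : finType) (L : {set {set T}}) (A B : {set T}) :
  mobius L A B =
  if A == B then 1 else - \sum_(C in L | (A \subset C) && (C \proper B)) mobius L A C.
Proof.
have stable n p (C : {set T}) : (#|C| <= n)%N -> (#|C| <= p)%N ->
    mobius_rec L n A C = mobius_rec L p A C.
  elim: n p C => [|n IHn] [|p] C //=.
  - rewrite leqn0 cards_eq0 => /eqP-> _; case: ifP => // _.
    rewrite big1 ?oppr0 // => D /and3P[_ _ /proper_card].
    by rewrite cards0.
  - move=> _; rewrite leqn0 cards_eq0 => /eqP->; case: ifP => // _.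
    rewrite big1 ?oppr0 // => D /and3P[_ _ /proper_card].
    by rewrite cards0.
  move=> leCn leCp; case: ifP => // _; congr (- _); apply: eq_bigr => D.
  case/and3P=> _ _ /proper_card ltDC.
  by apply: IHn; rewrite -ltnS; [apply: leq_trans leCn | apply: leq_trans leCp].
rewrite /mobius; case cB: #|B| => [|n] /=; case: ifP => // _.
  rewrite big1 ?oppr0 // => D /and3P[_ _ /proper_card].
  by rewrite cB.
congr (- _); apply: eq_bigr => D /and3P[_ _ /proper_card ltDB].
by apply: stable; rewrite // -ltnS -cB.
Qed.

Definition charpoly (T : finType) (M : matroid T) : {poly int} :=
  \sum_(F in flats M) mobius (flats M) (cl M set0) F *: 'X^(mrank M - rk M F).

(* recip n p is t^n p(t^-1), for p of degree at most n; see horner_recip. *)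
Definition recip (R : nzRingType) (n : nat) (p : {poly R}) : {poly R} :=
  \poly_(i < n.+1) p`_(n - i).

Lemma horner_recip (K : fieldType) (n : nat) (p : {poly K}) (x : K) :
  (size p <= n.+1)%N -> x != 0 -> (recip n p).[x] = x ^+ n * p.[x^-1].
Proof.
move=> szp nzx; rewrite horner_poly (horner_coef_wide _ szp) mulr_sumr.
rewrite (reindex_inj rev_ord_inj); apply: eq_bigr => i _ /=.
have lein : (i <= n)%N by rewrite -ltnS.
rewrite subSS subKn // mulrCA; congr (_ * _).
have -> : x ^+ n = x ^+ (n - i) * x ^+ i by rewrite -exprD subnK.
by rewrite exprVn mulfK // expf_neq0.
Qed.

Lemma size_charpoly (T : finType) (M : matroid T) :
  (size (charpoly M) <= (mrank M).+1)%N.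
Proof.
apply: leq_trans (size_sum _ _ _) _; apply/bigmax_leqP => F _.
by apply: leq_trans (size_scale_leq _ _) _; rewrite size_polyXn ltnS leq_subr.
Qed.

(* Q is the assignment M |-> Q_M of inverse Kazhdan-Lusztig polynomials.  In the
   degree bound, (size p).-1 is the degree of p (and 0 when p = 0). *)
Definition is_inverse_KL (Q : forall T : finType, matroid T -> {poly int}) : Prop :=
  forall (T : finType) (M : matroid T),
  [/\ mrank M = 0%N -> Q T M = 1,
      (0 < mrank M)%N -> ((size (Q T M)).-1.*2 < mrank M)%N &
      (-1) ^+ mrank M * recip (mrank M) (Q T M) =
      \sum_(F in flats M)
        (-1) ^+ mrank (restrict M F) * Q T (restrict M F) *
        recip (mrank (contract M F)) (charpoly (contract M F))].

(* Main.v *)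
(* Compare the coefficients of t^j, for 2 j < d, on both sides of the defining
   recursion for a matroid whose independent sets are the subsets of size at
   most d of an n-element ground set, n >= d.  The left side contributes nothing
   by the degree bound, and the flat E contributes (-1)^d Q_j, so Q_j is read
   off from the proper flats F, the sets of size i < d.  Their restrictions are
   Boolean with Q = 1, and M/F is uniform of rank d - i on n - i elements, whose
   characteristic polynomial is explicit.  The resulting alternating binomial
   sum telescopes.  The case n = d of the same computation shows, by induction,
   that Boolean matroids do have Q = 1. *)
Require Import Defs.
From mathcomp Require Import all_boot all_order all_algebra.
From mathcomp Require Import zify ring.

Set Implicit Arguments.
Unset Strict Implicit.
Unset Printing Implicit Defensive.

Import GRing.Theory Num.Theory.

Local Open Scope ring_scope.

(** * Sums over small subsets and truncated alternating binomial sums *)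

Lemma sum_subset_card (R : nmodType) (T : finType) (A : {set T}) (k : nat)
    (f : nat -> R) :
  \sum_(F : {set T} | (F \subset A) && (#|F| < k)%N) f #|F| =
  \sum_(i < k) f i *+ 'C(#|A|, i).
Proof.
have [-> | kgt0] := posnP k; first by rewrite big_ord0 big_pred0 // => F; rewrite ltn0 andbF.
case: k kgt0 => // k _.
rewrite (partition_big (fun F : {set T} => inord #|F| : 'I_k.+1) predT) //=.
apply: eq_bigr => i _; rewrite -cards_draws -sumr_const.
apply: congr_big => // [F | F].
  rewrite inE -andbA; case: (F \subset A) => //=.
  apply/andP/eqP => [[ltF /eqP <-] | cF]; first by rewrite inordK.
  by rewrite cF ltn_ord inord_val.
by case/andP=> /andP[_ ltF] /eqP <-; rewrite inordK.
Qed.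

(** By Pascal's rule each summand is a difference of consecutive terms [(-1) ^+ i *+ 'C(n, i)], so
    the sum telescopes. *)
Lemma alternating_sum_binomial (R : pzRingType) (n k : nat) :
  \sum_(i < k.+1) (-1) ^+ i *+ 'C(n.+1, i) = (-1) ^+ k *+ 'C(n, k) :> R.
Proof.
elim: k => [|k IHk]; first by rewrite big_ord_recr big_ord0 /= add0r !bin0.
by rewrite big_ord_recr IHk /= binS mulrnDr exprS mulN1r !mulNrn addrCA subrr addr0.
Qed.

Lemma coef_recip (R : nzRingType) (n : nat) (p : {poly R}) (j : nat) :
  (recip n p)`_j = if (j <= n)%N then p`_(n - j) else 0.
Proof. by rewrite coef_poly ltnS. Qed.

(** Unlike [uniform], this allows any ground set, so it is inherited by the restrictions and
    contractions used below; a rank equal to the size of the ground set gives the Boolean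
    matroids. *)
Definition is_uniform (T : finType) (d : nat) (M : matroid T) : Prop :=
  (d <= #|ground M|)%N /\
  indep M = [set I : {set T} | (I \subset ground M) && (#|I| <= d)%N].

Lemma uniform_is_uniform (m d : nat) : is_uniform d (uniform m d).
Proof.
split; first by rewrite /= cardsT card_ord leq_addl.
by apply/setP=> I; rewrite !inE subsetT.
Qed.

(** * Flats, Moebius function, characteristic polynomial and minors of uniform matroids *)

Section IsUniform.
Variables (T : finType) (d : nat) (M : matroid T).
Hypothesis UM : is_uniform d M.
Local Notation E := (ground M).
Implicit Types A F : {set T}.

Lemma rk_is_uniform A : A \subset E -> rk M A = minn d #|A|.
Proof.
case: UM => _ eqD sAE; apply/eqP; rewrite eqn_leq leq_min rk_le_card andbT.
apply/andP; split.
  by have [I /andP[] ] := rkP M A; rewrite eqD inE => /andP[_ leI] _ <-.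
have [I] : exists I, I \in [set I : {set T} | (I \subset A) && (#|I| == minn d #|A|)].
  by apply/card_gt0P; rewrite cards_draws bin_gt0 geq_minr.
rewrite inE => /andP[sIA /eqP cI].
rewrite -cI; apply: rk_ge => //.
by rewrite eqD inE (subset_trans sIA) //= cI geq_minl.
Qed.

Lemma mrank_is_uniform : mrank M = d.
Proof. by rewrite /mrank rk_is_uniform //; apply/minn_idPl; case: UM. Qed.

(** A new element increases [minn d #|A|] exactly while [#|A| < d]. *)
Lemma cl_is_uniform A : A \subset E -> cl M A = if (#|A| < d)%N then A else E.
Proof.
move=> sAE; apply/setP=> x; rewrite inE; case Ex: (x \in E) => /=; last first.
  case: ifP => _; last by rewrite Ex.
  by apply/esym/negP=> /(subsetP sAE); rewrite Ex.
rewrite !rk_is_uniform // ?subUset ?sub1set ?Ex // cardsU1.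
case: ltnP => ltA; last by rewrite Ex; lia.
case Ax: (x \in A) => /=; lia.
Qed.

Lemma flats_is_uniform F :
  (F \in flats M) = (F \subset E) && ((#|F| < d)%N || (F == E)).
Proof.
rewrite inE; case sFE: (F \subset E) => //=; rewrite cl_is_uniform //.
by case: ifP => _; rewrite ?eqxx // eq_sym.
Qed.

Lemma proper_flats_is_uniform F :
  (F \in flats M) && (F \proper E) = (F \subset E) && (#|F| < d)%N.
Proof.
case: UM => leE _; rewrite flats_is_uniform properEneq.
case sFE: (F \subset E) => //=; rewrite andbT.
case: (F =P E) => [->|_]; rewrite ?orbF ?andbT //=; lia.
Qed.

Lemma sum_flats_is_uniform (R : nmodType) (f : {set T} -> R) :
  \sum_(F in flats M) f F =
  f E + \sum_(F : {set T} | (F \subset E) && (#|F| < d)%N) f F.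
Proof.
rewrite (bigD1 E) /=; last by rewrite flats_is_uniform subxx eqxx orbT.
congr (_ + _); apply: eq_bigl => F; rewrite -proper_flats_is_uniform.
rewrite properEneq; case: (boolP (F \in flats M)) => //.
by rewrite inE => /andP[-> _]; rewrite andbT.
Qed.

(** Every subset of such an [F] is a flat, so the interval below [F] is a Boolean lattice. *)
Lemma mobius_lower_is_uniform F : F \subset E -> (#|F| < d)%N ->
  mobius (flats M) set0 F = (-1) ^+ #|F|.
Proof.
elim: {F}_.+1 {-2}F (ltnSn #|F|) => // n IHn F; rewrite ltnS => leFn sFE ltFd.
rewrite mobiusE; case: eqP => [<-|/eqP nF]; first by rewrite cards0.
have cF : #|F| = #|F|.-1.+1 by rewrite prednK // card_gt0 eq_sym.
rewrite (eq_bigl (fun C : {set T} => (C \subset F) && (#|C| < #|F|)%N)) => [|C].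
  rewrite (eq_bigr (fun C : {set T} => (-1) ^+ #|C|)) => [|C /andP[sCF ltCF]].
    rewrite (sum_subset_card F _ (fun i => (-1) ^+ i)) cF.
    by rewrite alternating_sum_binomial binn mulr1n exprS mulN1r.
  apply: IHn; [exact: leq_trans leFn | exact: subset_trans sFE | exact: ltn_trans ltFd].
rewrite sub0set andTb flats_is_uniform properEcard.
case sCF: (C \subset F); rewrite ?andbF //= (subset_trans sCF sFE) /=.
by case: (ltnP #|C| #|F|) => ltC; rewrite ?andbF //= (ltn_trans ltC).
Qed.

Lemma mobius_top_is_uniform : (0 < d)%N ->
  mobius (flats M) set0 E = (-1) ^+ d *+ 'C(#|E|.-1, d.-1).
Proof.
case: UM => leE _ d0; rewrite mobiusE eq_sym -cards_eq0 eqn0Ngt (leq_trans d0 leE) /=.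
rewrite (eq_bigl (fun C : {set T} => (C \subset E) && (#|C| < d)%N)) => [|C]; last first.
  by rewrite sub0set andTb proper_flats_is_uniform.
rewrite (eq_bigr (fun C : {set T} => (-1) ^+ #|C|)) => [|C /andP[]];
  last exact: mobius_lower_is_uniform.
rewrite (sum_subset_card E _ (fun i => (-1) ^+ i)).
have -> : #|E| = #|E|.-1.+1 by rewrite prednK // (leq_trans d0).
case: d d0 => // k _ /=.
by rewrite alternating_sum_binomial exprS mulN1r mulNrn.
Qed.

Lemma charpoly_is_uniform0 : d = 0%N -> charpoly M = 1.
Proof.
move=> d0; rewrite /charpoly sum_flats_is_uniform cl_is_uniform ?sub0set // d0 /=.
rewrite big_pred0 => [|F]; last by rewrite andbF.
by rewrite mobiusE eqxx scale1r /mrank subnn expr0 addr0.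
Qed.

(** Reversal turns the coefficient at [j] into the sum of Moebius values over the flats of rank [j]:
    the [j]-subsets if [j < d], only [E] if [j = d]. *)
Lemma coef_recip_charpoly_is_uniform (j : nat) : (0 < d)%N ->
  (recip d (charpoly M))`_j =
  if (j < d)%N then (-1) ^+ j *+ 'C(#|E|, j)
  else (-1) ^+ d *+ ((j == d) * 'C(#|E|.-1, d.-1)).
Proof.
move=> d0; rewrite coef_recip /charpoly sum_flats_is_uniform mrank_is_uniform.
rewrite cl_is_uniform ?sub0set // cards0 d0 mobius_top_is_uniform //.
rewrite rk_is_uniform // (minn_idPl _); last by case: UM.
rewrite coefD coefZ coefXn subnn coef_sum.
rewrite (eq_bigr (fun F : {set T} =>
   (-1) ^+ #|F| * (d - j == d - #|F|)%N%:R)) => [|F /andP[sFE ltF]]; last first.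
  rewrite coefZ coefXn mobius_lower_is_uniform // rk_is_uniform //.
  by rewrite (minn_idPr (ltnW ltF)).
rewrite (sum_subset_card E _ (fun i => (-1) ^+ i * (d - j == d - i)%N%:R)).
case: (ltngtP j d) => [ltjd | // | ->].
  rewrite (bigD1 (Ordinal ltjd)) //= eqxx mulr1 big1 => [|i neq].
    by rewrite subn_eq0 leqNgt ltjd mulr0 add0r addr0.
  have /negPf-> : (d - j != d - i)%N.
    by apply: contra neq => e; apply/eqP/val_inj => /=; have := ltn_ord i; lia.
  by rewrite mulr0 mul0rn.
rewrite big1 => [|i _]; first by rewrite subnn eqxx mulr1 addr0 mul1n.
by rewrite subnn eq_sym subn_eq0 leqNgt ltn_ord mulr0 mul0rn.
Qed.

Lemma restrict_is_uniform F : F \subset E -> (#|F| <= d)%N ->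
  is_uniform #|F| (restrict M F).
Proof.
case: UM => _ eqD sFE leF; split; first by rewrite /= (setIidPr sFE).
apply/setP=> I; rewrite /= !inE eqD inE (setIidPr sFE).
case sIF: (I \subset F); rewrite ?andbF // (subset_trans sIF sFE) /=.
by rewrite (subset_leq_card sIF) (leq_trans (subset_leq_card sIF)).
Qed.

(** Identifies the term of the flat [E] in the recursion as the one containing [Q M] itself. *)
Lemma restrict_ground : restrict M E = M.
Proof.
case: UM => _ eqD; apply: matroid_eq; first exact: setIid.
by apply/setP=> I; rewrite /= eqD !inE; case: (I \subset E); rewrite ?andbF ?andbT.
Qed.

(** Truncated subtraction gives rank 0 once [F] has at least [d] elements, which covers [F = E]. *)
Lemma contract_is_uniform F : F \subset E -> is_uniform (d - #|F|) (contract M F).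
Proof.
move=> sFE; have [leE eqD] := UM; split; first by rewrite /= cardsDS // leq_sub2r.
apply/setP=> I; rewrite !inE /=; case sI: (I \subset E :\: F) => //=.
move: sI; rewrite subsetD => /andP[sIE dIF].
rewrite !rk_is_uniform ?subUset ?sIE // cardsU (disjoint_setI0 dIF) cards0 subn0.
lia.
Qed.

End IsUniform.

(** * Binomial identities and the sum over proper flats *)

Lemma mul_bin_sub (n d k : nat) : (k <= d <= n)%N ->
  ('C(n, k) * 'C(n - k, d - k) = 'C(n, d) * 'C(d, k))%N.
Proof.
case/andP=> lekd ledn; have lekn := leq_trans lekd ledn.
have e1 := bin_fact lekn; have e2 := bin_fact (leq_sub2r k ledn).
have e3 := bin_fact ledn; have e4 := bin_fact lekd.
rewrite (_ : n - k - (d - k) = n - d)%N in e2; last lia.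
apply/eqP; rewrite -(eqn_pmul2r (fact_gt0 k)) -(eqn_pmul2r (fact_gt0 (d - k))).
rewrite -(eqn_pmul2r (fact_gt0 (n - d))); apply/eqP.
transitivity n`!; [rewrite -e1 -e2 | rewrite -e3 -e4]; ring.
Qed.

(** Both sides count pairs of disjoint subsets of sizes [i] and [j]. *)
Lemma mul_bin_swap (n i j : nat) : (i + j <= n)%N ->
  ('C(n, i) * 'C(n - i, j) = 'C(n, j) * 'C(n - j, i))%N.
Proof.
move=> le_n; have := @mul_bin_sub n (i + j) i; have := @mul_bin_sub n (i + j) j.
rewrite addnK addKn le_n leq_addr leq_addl => -> // -> //.
by rewrite -[X in _ = (_ * X)%N]bin_sub ?leq_addl // addnK.
Qed.

Lemma coef_signM (R : nzRingType) (k : nat) (p : {poly R}) (j : nat) :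
  ((-1) ^+ k * p)`_j = (-1) ^+ k * p`_j.
Proof. by rewrite -signr_odd -[in RHS]signr_odd !mulr_sign; case: odd; rewrite ?coefN. Qed.

(* The two terms come from the flats of size less than [d - j] and of size
   exactly [d - j] in the recursion; the second is absent when [j = 0]. *)
Definition uniform_inverse_KL_coef (n d j : nat) : int :=
  ('C(n, j) * 'C((n - j).-1, (d - j).-1))%:R -
  ((0 < j) * ('C(n, d - j) * 'C((n - d + j).-1, j.-1)))%:R.

Lemma uniform_inverse_KL_sum (n d j : nat) : (j < d <= n)%N ->
  \sum_(i < d) ((-1) ^+ i *
     (if (j < d - i)%N then (-1) ^+ j *+ 'C(n - i, j)
      else (-1) ^+ (d - i) *+ ((j == d - i)%N * 'C((n - i).-1, (d - i).-1)))) *+ 'C(n, i) =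
  - (-1) ^+ d * uniform_inverse_KL_coef n d j.
Proof.
case/andP=> ltjd ledn.
(* For flats of size [i], [a] is the contribution when [j] lies below the rank [d - i] of the
   contraction, [b] the one when [j] equals that rank. *)
pose a i : int := ((-1) ^+ i * ((-1) ^+ j *+ 'C(n - i, j))) *+ 'C(n, i).
pose b i : int := (-1) ^+ d *+ ((j == d - i) * 'C((n - i).-1, (d - i).-1) * 'C(n, i))%N.
rewrite (eq_bigr (fun i : 'I_d => (if (i < d - j)%N then a i else 0) + b i)); last first.
  move=> i _; have lti := ltn_ord i; rewrite /a /b; have -> : (i < d - j)%N = (j < d - i)%N by lia.
  case: ltnP => ltj; first by rewrite ltn_eqF // !mul0n mulr0n addr0.
  by rewrite add0r mulrnAr -exprD subnKC ?(ltnW lti) // -mulrnA.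
rewrite big_split /=; have -> : \sum_(i < d) (if (i < d - j)%N then a i else 0) =
    - (-1) ^+ d * ('C(n, j) * 'C((n - j).-1, (d - j).-1))%:R.
  (* Swapping the binomials pulls out ['C(n, j)] and leaves an alternating sum in [i], cut off at
     [d - j]. *)
  rewrite -big_mkcond -(big_ord_widen d a) ?leq_subr //.
  rewrite (eq_bigr (fun i : 'I_(d - j) => (-1) ^+ j *+ 'C(n, j) * ((-1) ^+ i *+ 'C(n - j, i)))).
    rewrite -mulr_sumr.
    have [-> e] : (d - j = (d - j).-1.+1 /\ n - j = (n - j).-1.+1)%N by lia.
    rewrite e alternating_sum_binomial /= mulrnAl mulrnAr -exprD.
    have -> : - (-1) ^+ d = (-1) ^+ (j + (d - j).-1) :> int.
      by rewrite [in LHS](_ : d = (j + (d - j).-1).+1) ?exprS ?mulN1r ?opprK //; lia.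
    by rewrite mulr_natr -mulrnA mulnC.
  move=> i _; have lti := ltn_ord i; rewrite /a mulrnAr -mulrnA mulnC mul_bin_swap; last lia.
  by rewrite mulrnAl mulrnAr -mulrnA -!exprD addnC [X in _ *+ X]mulnC.
rewrite /uniform_inverse_KL_coef mulrBr mulNr; congr (_ + _); rewrite mulNr opprK mulr_natr.
(* [b] is nonzero only at [i = d - j], which is outside the range [i < d] when [j = 0]. *)
case: j @a @b ltjd => [|j] a b ltjd.
  rewrite mul0n mulr0n big1 // => i _; rewrite /b (_ : _ == _ = false) //.
  by have := ltn_ord i; lia.
have ltdj : (d - j.+1 < d)%N by lia.
rewrite (bigD1 (Ordinal ltdj)) //= big1 => [|i neq]; rewrite /b.
  rewrite addr0 (_ : d - (d - j.+1) = j.+1)%N; last lia.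
  by rewrite (_ : n - (d - j.+1) = n - d + j.+1)%N ?eqxx ?mul1n 1?mulnC //; lia.
rewrite (_ : _ == _ = false) //; apply: contraNF neq => /eqP e.
by apply/eqP/val_inj => /=; have := ltn_ord i; lia.
Qed.

(** * Coefficients of Q from the defining recursion *)

Section InverseKL.
Variable Q : forall T : finType, matroid T -> {poly int}.
Hypothesis HQ : is_inverse_KL Q.

Lemma inverse_KL_coef_eq0 (T : finType) (M : matroid T) (j : nat) :
  (0 < mrank M)%N -> (mrank M <= j.*2)%N -> (Q M)`_j = 0.
Proof.
case: (HQ M) => _ szQ _ /szQ ltQ leM; apply: nth_default.
by move: ltQ leM; case: size => [|k] //=; lia.
Qed.

(** Assuming Q = 1 on proper restrictions lets this lemma serve inside the induction that proves Q =
    1 for Boolean matroids. *)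
Lemma inverse_KL_coef_is_uniform (T : finType) (d : nat) (M : matroid T) (j : nat) :
    is_uniform d M ->
    (forall F : {set T}, F \subset ground M -> (#|F| < d)%N -> Q (restrict M F) = 1) ->
    (j.*2 < d)%N ->
  (Q M)`_j = uniform_inverse_KL_coef #|ground M| d j.
Proof.
move=> UM Q1 ltj; have [leE _] := UM; have d0 : (0 < d)%N by lia.
have rM := mrank_is_uniform UM; have [_ _] := HQ M; rewrite rM.
move/(congr1 (fun p : {poly int} => p`_j)).
(* As [2 j < d], the index [d - j] is beyond the degree bound, so the left side vanishes. *)
rewrite coef_signM coef_recip (@inverse_KL_coef_eq0 _ _ (d - j)%N) ?rM //; last lia.
rewrite if_same mulr0 (sum_flats_is_uniform UM) (restrict_ground UM) rM.
have UE := contract_is_uniform UM (subxx (ground M)).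
have e0 : (d - #|ground M| = 0)%N by lia.
rewrite (mrank_is_uniform UE) (charpoly_is_uniform0 UE) // e0.
have -> : recip 0 1 = 1 :> {poly int}.
  by apply/polyP=> -[|k]; rewrite coef_recip !coef1.
rewrite mulr1 coefD coef_signM coef_sum.
pose f i : int := (-1) ^+ i *
     (if (j < d - i)%N then (-1) ^+ j *+ 'C(#|ground M| - i, j)
      else (-1) ^+ (d - i) *+ ((j == d - i)%N * 'C((#|ground M| - i).-1, (d - i).-1))).
rewrite (eq_bigr (fun F : {set T} => f #|F|)) => [|F /andP[sF ltF]]; last first.
  rewrite Q1 // mulr1 (mrank_is_uniform (restrict_is_uniform UM sF (ltnW ltF))).
  have UF := contract_is_uniform UM sF.
  rewrite (mrank_is_uniform UF) coef_signM (coef_recip_charpoly_is_uniform UF) ?subn_gt0 //.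
  by rewrite /= cardsDS.
rewrite (sum_subset_card (ground M) _ f) uniform_inverse_KL_sum ?leE; last by lia.
(* The recursion now says that a sign times the difference of the two sides is 0. *)
rewrite mulNr -mulrBr => /esym/eqP; rewrite mulf_eq0 signr_eq0 subr_eq0.
by move/eqP.
Qed.

Lemma inverse_KL_free (T : finType) (M : matroid T) :
  is_uniform #|ground M| M -> Q M = 1.
Proof.
move: {2}_.+1 (ltnSn #|ground M|) => n; elim: n T M => // n IHn T M lt_n UM.
have rM := mrank_is_uniform UM.
have [E0|E0] := posnP #|ground M|; first by have [-> //] := HQ M; rewrite rM.
apply/polyP=> j; rewrite coef1; case: (leqP #|ground M| j.*2) => lej.
  by rewrite inverse_KL_coef_eq0 ?rM // (_ : _ == _ = false) //; lia.
rewrite (inverse_KL_coef_is_uniform UM) // => [|F sF ltF].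
  (* With [n = d] both terms equal ['C(n, j)], so they cancel unless [j = 0], where the second is
     absent. *)
  rewrite /uniform_inverse_KL_coef subnn add0n !binn !muln1 bin_sub; last lia.
  by case: j lej => [|j] _; rewrite ?bin0 ?mul0n ?subr0 // mul1n subrr.
apply: IHn; rewrite /= (setIidPr sF); first lia.
exact: restrict_is_uniform (ltnW ltF).
Qed.

End InverseKL.

(** By absorption the two terms are ['C(m + d, d) * 'C(d, j)] times (d-j)/(m+d-j) and j/(m+j); the
    numerator of the difference is (d-j)(m+j) - j(m+d-j) = m(d-2j). *)
Lemma uniform_inverse_KL_coefE (m d j : nat) : (0 < m)%N -> (j < d)%N ->
  (uniform_inverse_KL_coef (m + d) d j)%:~R =
  'C(m + d, d)%:R * ((m%:R * (d%:R - 2 * j%:R)) / ((m%:R + j%:R) * (m%:R + d%:R - j%:R))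
         * 'C(d, j)%:R) :> rat.
Proof.
move=> m0 ltjd; rewrite /uniform_inverse_KL_coef rmorphB /= !rmorph_nat addnK.
have e1 : ((m + d - j) * ('C(m + d, j) * 'C((m + d - j).-1, (d - j).-1)) =
           (d - j) * ('C(m + d, d) * 'C(d, j)))%N.
  rewrite mulnCA mul_bin_diag prednK ?subn_gt0 // mulnCA mul_bin_sub //; lia.
have e2 : ((m + j) * ((0 < j) * ('C(m + d, d - j) * 'C((m + j).-1, j.-1))) =
           j * ('C(m + d, d) * 'C(d, j)))%N.
  case: j ltjd {e1} => [|j] ltjd; first by rewrite muln0.
  rewrite mul1n mulnCA mul_bin_diag mulnCA -[in RHS](@bin_sub d) ?(ltnW ltjd) //.
  rewrite -(@mul_bin_sub (m + d)); last by lia.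
  by rewrite subKn ?(ltnW ltjd) // (_ : m + d - (d - j.+1) = m + j.+1)%N //; lia.
move/(congr1 (fun k => k%:R : rat)): e1; move/(congr1 (fun k => k%:R : rat)): e2.
move: (_ * 'C((m + d - j).-1, _))%N (_ * (_ * 'C((m + j).-1, _)))%N => x y.
have nz1 : m%:R + j%:R != 0 :> rat by rewrite -natrD pnatr_eq0; lia.
have nz2 : m%:R + d%:R - j%:R != 0 :> rat.
  by rewrite -natrD -natrB ?pnatr_eq0; lia.
rewrite !natrM !natrB ?natrD; [|lia|lia] => e2 e1.
apply: (mulfI nz1); apply: (mulfI nz2); rewrite mulrBr.
rewrite mulrBr [_ * (_ * x%:R)]mulrCA e1 e2; field.
by rewrite nz1 nz2.
Qed.

Theorem theorem3p3 (Q : forall T : finType, matroid T -> {poly int})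
    (HQ : is_inverse_KL Q) (m d : nat) (hm : (1 <= m)%N) (hd : (1 <= d)%N) :
  map_poly (intr : int -> rat) (Q _ (uniform m d)) =
  'C(m + d, d)%:R *:
    \sum_(j < ((d - 1) %/ 2).+1)
      ((m%:R * (d%:R - 2 * j%:R)) / ((m%:R + j%:R) * (m%:R + d%:R - j%:R))
         * 'C(d, j)%:R) *: 'X^j.
Proof.
have UM := uniform_is_uniform m d; have rM := mrank_is_uniform UM.
pose c (j : nat) : rat := (m%:R * (d%:R - 2 * j%:R)) /
  ((m%:R + j%:R) * (m%:R + d%:R - j%:R)) * 'C(d, j)%:R.
rewrite -(poly_def ((d - 1) %/ 2).+1 c).
apply/polyP=> j; rewrite coef_map coefZ coef_poly.
(* Beyond the summation range [d <= 2 j], so the degree bound makes the coefficient 0. *)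
case: ifP => ltj; last by rewrite (inverse_KL_coef_eq0 HQ) ?rM ?mulr0 //; lia.
rewrite (inverse_KL_coef_is_uniform HQ UM); last by lia.
  by rewrite /= cardsT card_ord uniform_inverse_KL_coefE //; lia.
move=> F sF ltF; apply: (inverse_KL_free HQ); rewrite [ground _](setIidPr sF).
exact: (restrict_is_uniform UM sF (ltnW ltF)).
Qed.
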